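(* Let a list of real numbers $\sigma=(\lambda_1,\lambda_2,\dots,\lambda_5)$, where $\lambda_1\ge\lambda_2\ge\dots\ge\lambda_5\ge-\lambda_1$, be the spectrum of a trace zero $5\times5$ symmetric nonnegative matrix. Then $\sigma_i^{-s}$ is realizable by a trace zero $5\times5$ symmetric nonnegative matrix for any positive real number $s$ and any $i\in\{2,3,4,5\}$.
   Context: For $s>0$ and $i\in\{2,\dots,5\}$, $\sigma_i^{-s}$ denotes the list $\sigma$ with $\lambda_1$ replaced by $\lambda_1+s$ and $\lambda_i$ replaced by $\lambda_i-s$. A matrix is nonnegative if all its entries are nonnegative real numbers. A list is realizable by a matrix if it is the spectrum of that matrix, eigenvalues being counted with multiplicity and the order of the list being irrelevant. *)

(* Defs.v *)
From HB Require Import structures.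
From mathcomp Require Import all_boot all_order all_algebra.
From mathcomp Require Import reals.

Set Implicit Arguments.
Unset Strict Implicit.
Unset Printing Implicit Defensive.

Import Order.TTheory GRing.Theory Num.Theory.
Local Open Scope ring_scope.

(* All eigenvalues of A, with algebraic multiplicity and in any order. *)
Definition has_spectrum (R : realType) (n : nat) (A : 'M[R]_n)
    (sigma : n.-tuple R) : Prop :=
  char_poly A = \prod_(x <- sigma) ('X - x%:P).

Definition tz_sym_nonneg_mx (R : realType) (n : nat) (A : 'M[R]_n) : Prop :=
  [/\ A^T = A, (forall i j, 0 <= A i j) & \tr A = 0].

Definition tz_sym_realizable (R : realType) (n : nat) (sigma : n.-tuple R) : Prop :=
  exists A : 'M[R]_n, tz_sym_nonneg_mx A /\ has_spectrum A sigma.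

(* sigma_i^{-s}. Entries are numbered from 0, so the first entry lambda_1 has
   index ord0; intended for i != ord0. *)
Definition perturb (R : realType) (n : nat) (sigma : n.+1.-tuple R)
    (i : 'I_n.+1) (s : R) : n.+1.-tuple R :=
  [tuple if j == ord0 then tnth sigma j + s
         else if j == i then tnth sigma j - s
         else tnth sigma j | j < n.+1].

(* Main.v *)
Require Import Defs.
From HB Require Import structures.
From mathcomp Require Import all_boot all_order all_algebra.
From mathcomp Require Import reals.
From mathcomp Require Import complex.
From mathcomp Require Import ring lra zify.

Set Implicit Arguments.
Unset Strict Implicit.
Unset Printing Implicit Defensive.

Import Order.TTheory GRing.Theory Num.Theory.
Local Open Scope ring_scope.

(** A trace zero list [l1 >= l2 >= l3 >= l4 >= l5 >= - l1] is the spectrum of a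
    trace zero symmetric nonnegative 5x5 matrix iff its cubes have a nonnegative
    sum and [l2 + l5 <= 0] (Spector). Both conditions survive the perturbation:
    the sum of cubes grows by [3 s (l1 + li) (l1 - li + s)], and no entry but the
    first one grows.

    Necessity: the sum of cubes is [tr A^3]. If [l2 > 0], orthogonal eigenvectors
    for [l1] and [l2] cannot both be of one sign with at least three nonzero
    entries, so one of them, up to sign, has one or two positive entries. The
    eigenvalue equation at the largest of these yields an entry [A i j >= l2],
    and the Rayleigh quotient of [e_i - e_j] is [- A i j], so [l5 <= - l2].

    Sufficiency: if [l3 <= 0], join matrices with spectra [(- l3 - l4, l3, l4)] and
    [(- l5, l5)] along their Perron vectors. If [l3 > 0], use a matrix invariant
    under the involution [(1 4)(2 3)] of the indices; its antisymmetric part takes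
    the eigenvalues [l3, l4], and its remaining parameter solves a quadratic
    equation with a nonnegative root by the condition on the cubes. *)

(** * Explicit characteristic polynomials *)

(** Expansion along the first row with entries indexed by [nat]: for a concrete [n] it computes to a
    polynomial expression that [ring] can handle. *)
Fixpoint laplace_det (K : pzRingType) n (F : nat -> nat -> K) : K :=
  if n is m.+1 then
    foldr +%R 0 [seq (if odd j then - F 0%N j else F 0%N j)
       * laplace_det m (fun i k => F i.+1 (if (j <= k)%N then k.+1 else k)) | j <- iota 0 n]
  else 1.

Lemma laplace_detE (K : comPzRingType) n (F : nat -> nat -> K) :
  \det (\matrix_(i < n, j < n) F i j) = laplace_det n F.
Proof.
elim: n F => [|n IHn] F; first by rewrite det_mx00.
rewrite (expand_det_row _ ord0) /laplace_det -/laplace_det foldrE big_map.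
rewrite -[iota 0 n.+1]/(index_iota 0 n.+1) big_mkord.
apply: eq_bigr => j _; rewrite mxE /cofactor add0n -IHn mulrA; congr (_ * _).
  by rewrite -signr_odd; case: odd; rewrite ?mulrN1 ?mulr1.
by congr (\det _); apply/matrixP => i k; rewrite !mxE /= /bump leq0n add1n; case: leqP.
Qed.

(* The diagonal entry is a parameter so that the entries of [char_poly_mx (sym5 _)]
   have the same form. *)
Definition sym5_entry (K : pzRingType) (x a01 a02 a03 a04 a12 a13 a14 a23 a24 a34 : K)
    (i j : nat) : K :=
  nth 0 (nth [::] [:: [:: x; a01; a02; a03; a04]; [:: a01; x; a12; a13; a14];
    [:: a02; a12; x; a23; a24]; [:: a03; a13; a23; x; a34]; [:: a04; a14; a24; a34; x]] i) j.

Definition sym5 (K : pzRingType) (a01 a02 a03 a04 a12 a13 a14 a23 a24 a34 : K) : 'M[K]_5 :=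
  \matrix_(i, j) sym5_entry 0 a01 a02 a03 a04 a12 a13 a14 a23 a24 a34 i j.

Lemma char_poly_sym5 (K : comNzRingType) (a01 a02 a03 a04 a12 a13 a14 a23 a24 a34 : K) :
  char_poly (sym5 a01 a02 a03 a04 a12 a13 a14 a23 a24 a34) =
  laplace_det 5 (sym5_entry 'X (- a01%:P) (- a02%:P) (- a03%:P) (- a04%:P) (- a12%:P)
    (- a13%:P) (- a14%:P) (- a23%:P) (- a24%:P) (- a34%:P)).
Proof.
rewrite -laplace_detE; congr (\det _); apply/matrixP => i j; rewrite !mxE.
case: i j => [[|[|[|[|[|//]]]]] ?] [[|[|[|[|[|//]]]]] ?];
  by rewrite /sym5_entry /= ?mulr1n ?mulr0n ?subr0 ?sub0r.
Qed.

Lemma sym5_tz_sym_nonneg (R : realType) (a01 a02 a03 a04 a12 a13 a14 a23 a24 a34 : R) :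
  all (fun a => 0 <= a) [:: a01; a02; a03; a04; a12; a13; a14; a23; a24; a34] ->
  tz_sym_nonneg_mx (sym5 a01 a02 a03 a04 a12 a13 a14 a23 a24 a34).
Proof.
move=> /= /and5P[? ? ? ? /and5P[? ? ? ? /and3P[? ? _]]]; split.
- apply/matrixP => i j; rewrite !mxE.
  by case: i j => [[|[|[|[|[|//]]]]] ?] [[|[|[|[|[|//]]]]] ?].
- move=> i j; rewrite !mxE.
  by case: i j => [[|[|[|[|[|//]]]]] ?] [[|[|[|[|[|//]]]]] ?].
- by apply: big1 => i _; rewrite mxE; case: i => [[|[|[|[|[|//]]]]] ?].
Qed.

(** The matrix is invariant under the transpositions (0 1) and (3 4). The vectors [e_0 - e_1] and
    [e_3 - e_4] give the linear factors; the cubic belongs to the vectors fixed by both. *)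
Lemma char_poly_sym5_two_pairs (K : comNzRingType) (p q x y z : K) :
  char_poly (sym5 p x y y x y y z z q) =
  ('X + p%:P) * ('X + q%:P) *
  ('X^3 - (p + q)%:P * 'X^2 + (p * q - 2 * x ^+ 2 - 4 * y ^+ 2 - 2 * z ^+ 2)%:P * 'X
   - (8 * x * y * z - 2 * q * x ^+ 2 - 2 * p * z ^+ 2)%:P).
Proof.
rewrite char_poly_sym5.
cbv [laplace_det foldr map iota nth odd negb sym5_entry] => /=.
by ring.
Qed.

(* The matrix commutes with the permutation (1 4)(2 3): the quadratic factor comes
   from the antisymmetric vectors, the cubic one from the symmetric vectors. *)
Lemma char_poly_sym5_reflection (K : comNzRingType) (a b c d : K) :
  char_poly (sym5 b d d b c 0 0 a 0 c) =
  ('X^2 + a%:P * 'X - (c ^+ 2)%:P) *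
  ('X^3 - a%:P * 'X^2 + (- (c ^+ 2 + 2 * b ^+ 2 + 2 * d ^+ 2))%:P * 'X
   - (4 * b * c * d - 2 * a * b ^+ 2)%:P).
Proof.
rewrite char_poly_sym5.
cbv [laplace_det foldr map iota nth odd negb sym5_entry] => /=.
by ring.
Qed.

(** * Realizing matrices *)

Lemma cubic_factor (K : comNzRingType) (e1 e2 e3 r1 r2 r3 : K) :
  e1 = r1 + r2 + r3 -> e2 = r1 * r2 + r1 * r3 + r2 * r3 -> e3 = r1 * r2 * r3 ->
  'X^3 - e1%:P * 'X^2 + e2%:P * 'X - e3%:P =
  ('X - r1%:P) * ('X - r2%:P) * ('X - r3%:P).
Proof. by move=> -> -> ->; ring. Qed.

Definition tz_sym_realizable_seq (R : realType) (n : nat) (s : seq R) : Prop :=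
  exists A : 'M[R]_n, tz_sym_nonneg_mx A /\ char_poly A = \prod_(x <- s) ('X - x%:P).

Lemma tz_sym_realizable_two_pairs (R : realType) (l1 l2 p1 p2 q : R) :
  0 <= p1 -> 0 <= p2 -> 0 <= q -> l1 + l2 = p1 + p2 + q ->
  l2 <= q -> l2 <= p1 + p2 -> - p1 <= l2 ->
  tz_sym_realizable_seq 5 [:: l1; l2; - p1; - p2; - q].
Proof.
move=> p1_ge0 p2_ge0 q_ge0 sumE l2_le l2_le' l2_ge.
have l1E : l1 = p1 + p2 + q - l2 by rewrite -sumE; ring.
(* The block on the indices 0, 1, 2 will have eigenvalues [p1 + p2], [- p1], [- p2] and map
   [(h / 2, h / 2, g)] to [p1 + p2] times itself. Coupling this vector to [(1, 1)] with weight [t]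
   only mixes [p1 + p2] and [q]; they become [l1] and [l2] once the determinant
   [(p1 + p2) * q - t ^+ 2 * (2 * p1 + p2)] is [l1 * l2]. *)
pose g : R := Num.sqrt (p1 / 2); pose h : R := Num.sqrt (p1 + p2).
pose t : R := Num.sqrt ((p1 + p2 - l2) * (q - l2) / (2 * p1 + p2)).
have g2 : g ^+ 2 = p1 / 2 by rewrite sqr_sqrtr // divr_ge0.
have h2 : h ^+ 2 = p1 + p2 by rewrite sqr_sqrtr // addr_ge0.
have t2 : t ^+ 2 * (2 * p1 + p2) = (p1 + p2 - l2) * (q - l2).
  rewrite sqr_sqrtr; last by rewrite divr_ge0 ?mulr_ge0 //; lra.
  have [eq0|neq0] := eqVneq (2 * p1 + p2) 0; last by rewrite divfK.
  (* Division by zero: here [p1 = p2 = 0], which forces [l2 = 0]. *)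
  have -> : p1 + p2 - l2 = 0 by lra.
  by rewrite eq0 mulr0 mul0r.
exists (sym5 p2 (g * h) (t * h / 2) (t * h / 2) (g * h) (t * h / 2) (t * h / 2)
  (t * g) (t * g) q); split.
  have g_ge0 : 0 <= g := sqrtr_ge0 _.
  have h_ge0 : 0 <= h := sqrtr_ge0 _.
  have t_ge0 : 0 <= t := sqrtr_ge0 _.
  by apply: sym5_tz_sym_nonneg; rewrite /= p2_ge0 q_ge0 ?(divr_ge0, mulr_ge0).
rewrite char_poly_sym5_two_pairs (@cubic_factor _ _ _ _ l1 l2 (- p1)).
- by rewrite !big_cons big_nil !polyCN; ring.
- by lra.
- have -> : p2 * q - 2 * (g * h) ^+ 2 - 4 * (t * h / 2) ^+ 2 - 2 * (t * g) ^+ 2 =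
      p2 * q - 2 * g ^+ 2 * h ^+ 2 - t ^+ 2 * h ^+ 2 - 2 * t ^+ 2 * g ^+ 2 by field.
  rewrite g2 h2 l1E.
  have -> : p2 * q - 2 * (p1 / 2) * (p1 + p2) - t ^+ 2 * (p1 + p2) - 2 * t ^+ 2 * (p1 / 2) =
      p2 * q - p1 * (p1 + p2) - t ^+ 2 * (2 * p1 + p2) by field.
  by rewrite t2; ring.
- have -> : 8 * (g * h) * (t * h / 2) * (t * g) - 2 * q * (g * h) ^+ 2
      - 2 * p2 * (t * g) ^+ 2 =
      4 * g ^+ 2 * h ^+ 2 * t ^+ 2 - 2 * q * g ^+ 2 * h ^+ 2
      - 2 * p2 * t ^+ 2 * g ^+ 2 by field.
  rewrite g2 h2 l1E.
  have -> : 4 * (p1 / 2) * (p1 + p2) * t ^+ 2 - 2 * q * (p1 / 2) * (p1 + p2)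
      - 2 * p2 * t ^+ 2 * (p1 / 2) =
      p1 * (t ^+ 2 * (2 * p1 + p2) - q * (p1 + p2)) by field.
  by rewrite t2; ring.
Qed.

Lemma tz_sym_realizable_reflection (R : realType) (l1 l2 mu p q : R) :
  0 < l1 -> 0 < l2 -> 0 < mu -> p <= q -> q <= l1 -> l1 + l2 + mu = p + q ->
  0 <= l1 ^+ 3 + l2 ^+ 3 + mu ^+ 3 - p ^+ 3 - q ^+ 3 ->
  tz_sym_realizable_seq 5 [:: l1; l2; mu; - p; - q].
Proof.
move=> l1_gt0 l2_gt0 mu_gt0 p_le q_le sumE cubes_ge0.
have pE : p = l1 + l2 + mu - q by rewrite sumE; ring.
(* [p - mu] is the entry [a] of the reflection-invariant matrix: with [c ^+ 2 = p * mu] the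
   quadratic factor is [('X - mu) * ('X + p)]. *)
have a_gt0 : 0 < p - mu by lra.
pose S := (q * (l1 + l2) - l1 * l2 - p * mu) / 2.
(* [S] is to become [b ^+ 2 + d ^+ 2], as dictated by the [l1, l2, - q] part. *)
have S_gt0 : 0 < S.
  rewrite divr_gt0 //.
  have -> : q * (l1 + l2) - l1 * l2 - p * mu =
    (l1 - q) * (q - l2) + q * (q - mu) + mu * (q - p) by ring.
  have : 0 <= (l1 - q) * (q - l2) by apply: mulr_ge0; lra.
  have : 0 < q * (q - mu) by apply: mulr_gt0; lra.
  have : 0 <= mu * (q - p) by apply: mulr_ge0; lra.
  by lra.
pose c : R := Num.sqrt (p * mu).
have c2 : c ^+ 2 = p * mu by rewrite sqr_sqrtr // mulr_ge0; lra.
(* Substituting [d = t * b] and [b ^+ 2 = S / (1 + t ^+ 2)] in the constant coefficient of the cubic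
   leaves an equation for [t] alone, with [k] as leading coefficient. *)
pose k : R := l1 * l2 * q / S.
have k_gt0 : 0 < k by rewrite divr_gt0 // !mulr_gt0 //; lra.
(* The sum of cubes equals [3 * (2 * (p - mu) * S - l1 * l2 * q)]. *)
have k_le : k <= 2 * (p - mu).
  rewrite ler_pdivrMr // -subr_ge0 -(pmulr_rge0 _ (_ : 0 < 3)) //.
  apply: le_trans cubes_ge0 _; rewrite le_eqVlt; apply/orP; left; apply/eqP.
  by rewrite /S pE; field.
have kk_ge0 : 0 <= k * (2 * (p - mu) - k) by apply: mulr_ge0; lra.
pose t : R := (Num.sqrt (4 * c ^+ 2 + k * (2 * (p - mu) - k)) - 2 * c) / k.
have t_ge0 : 0 <= t.
  rewrite divr_ge0 ?(ltW k_gt0) // subr_ge0 -[leLHS]ger0_norm ?mulr_ge0 ?sqrtr_ge0 //.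
  rewrite -sqrtr_sqr ler_wsqrtr // exprMn.
  by lra.
(* The ratio [t = d / b] solves [k t^2 + 4 c t + (k - 2 (p - mu)) = 0]. *)
have t_root : 4 * c * t - 2 * (p - mu) = - k * (1 + t ^+ 2).
  have : (k * t + 2 * c) ^+ 2 = 4 * c ^+ 2 + k * (2 * (p - mu) - k).
    rewrite mulrC divfK ?gt_eqF // subrK sqr_sqrtr //.
    by have := sqr_ge0 c; lra.
  move=> sqE; apply: (mulfI (lt0r_neq0 k_gt0)).
  by have := sqE; rewrite sqrrD; lra.
have t2_gt0 : 0 < 1 + t ^+ 2 by rewrite ltr_pwDl ?sqr_ge0.
pose b : R := Num.sqrt (S / (1 + t ^+ 2)).
have b2 : b ^+ 2 * (1 + t ^+ 2) = S.
  by rewrite sqr_sqrtr ?divfK ?gt_eqF // ltW // divr_gt0.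
exists (sym5 b (t * b) (t * b) b c 0 0 (p - mu) 0 c); split.
  have b_ge0 : 0 <= b := sqrtr_ge0 _.
  have c_ge0 : 0 <= c := sqrtr_ge0 _.
  by apply: sym5_tz_sym_nonneg; rewrite /= b_ge0 c_ge0 mulr_ge0 ?(ltW a_gt0) ?lexx.
have b3 : 4 * b * c * (t * b) - 2 * (p - mu) * b ^+ 2 = l1 * l2 * - q.
  have -> : 4 * b * c * (t * b) - 2 * (p - mu) * b ^+ 2 =
    b ^+ 2 * (4 * c * t - 2 * (p - mu)) by ring.
  rewrite t_root mulrCA b2 mulNr divfK ?gt_eqF //; ring.
have b2' : - (c ^+ 2 + 2 * b ^+ 2 + 2 * (t * b) ^+ 2) = l1 * l2 + l1 * - q + l2 * - q.
  have -> : c ^+ 2 + 2 * b ^+ 2 + 2 * (t * b) ^+ 2 =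
    c ^+ 2 + 2 * (b ^+ 2 * (1 + t ^+ 2)) by ring.
  by rewrite b2 c2 /S; field.
rewrite char_poly_sym5_reflection b3 b2' c2.
rewrite (@cubic_factor _ _ _ _ l1 l2 (- q)) //; last by rewrite pE; ring.
by rewrite !big_cons big_nil !polyCN; ring.
Qed.

(** * Spectral theory of real symmetric matrices *)

Lemma char_poly_similar (K : comUnitRingType) n (P D : 'M[K]_n) :
  P \in unitmx -> char_poly (invmx P *m D *m P) = char_poly D.
Proof.
move=> Pu; rewrite /char_poly.
have -> : char_poly_mx (invmx P *m D *m P) =
    map_mx polyC (invmx P) *m char_poly_mx D *m map_mx polyC P.
  rewrite /char_poly_mx mulmxBr mulmxBl !map_mxM /= scalar_mxC -(mulmxA 'X%:M).
  by rewrite -(map_mxM _ (invmx P) P) mulVmx // map_mx1 mulmx1.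
rewrite !det_mulmx mulrAC -det_mulmx -map_mxM mulVmx // map_mx1.
by rewrite det1 mul1r.
Qed.

Local Notation toC := (real_complex _).

(** Over [R[i]] the matrix is Hermitian, hence unitarily diagonalizable; its eigenvalues are real
    because they are a rearrangement of [s]. *)
Lemma sym_spectral (R : rcfType) n (A : 'M[R]_n) (s : n.-tuple R) :
  A^T = A -> char_poly A = \prod_(x <- s) ('X - x%:P) ->
  exists (P : 'M[R[i]]_n) (e : 'rV[R]_n),
    [/\ P \in unitmx, invmx P = map_mx Num.conj P^T,
        map_mx toC A = invmx P *m diag_mx (map_mx toC e) *m P
      & perm_eq s [seq e 0 k | k : 'I_n]].
Proof.
move=> Asym Aspec; pose AC := map_mx (real_complex R) A.
have AC_herm : AC \is hermsymmx.
  apply: realsym_hermsym.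
    by apply/is_hermitianmxP; rewrite expr0 scale1r map_mx_id // /AC map_trmx Asym.
  by apply/mxOverP => i j; rewrite mxE; apply/complex_realP; exists (A i j).
have /orthomx_spectralP := hermitian_normalmx AC_herm.
set P := spectralmx _; set sp := spectral_diag _ => ACE.
have Punit : P \in unitmx by apply: spectral_unit.
have sp_s : perm_eq [seq sp 0 i | i : 'I_n] [seq real_complex R x | x <- s].
  apply: prod_XsubC_eq; rewrite big_image big_map /=.
  have /(congr1 (map_poly (real_complex R))) := Aspec.
  rewrite map_char_poly map_prod_XsubC => <-.
  rewrite -/AC ACE char_poly_similar // char_poly_trig ?diag_mx_is_trig //.
  by apply: eq_bigr => i _; rewrite mxE eqxx mulr1n.
have spE : map_mx toC (map_mx (@complex.Re R) sp) = sp.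
  apply/rowP => i; rewrite !mxE.
  have : sp 0 i \in [seq real_complex R x | x <- s].
    by rewrite -(perm_mem sp_s); apply: image_f.
  by case/mapP => x _ ->.
exists P, (map_mx (@complex.Re R) sp); split; [done| | by rewrite spE |].
  by rewrite invmx_unitary // spectral_unitarymx.
have /(perm_map (@complex.Re R)) := sp_s.
rewrite perm_sym -map_comp map_id => /perm_trans-> //.
rewrite -map_comp (eq_map (_ : _ =1 fun k => map_mx (@complex.Re R) sp 0 k)) //.
by move=> i /=; rewrite mxE.
Qed.

Lemma conj_diag_mx_exp (K : comUnitRingType) n (P : 'M[K]_n.+1) (d : 'rV[K]_n.+1) k :
  P \in unitmx ->
  (invmx P *m diag_mx d *m P) ^+ k = invmx P *m diag_mx (map_mx (fun x => x ^+ k) d) *m P.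
Proof.
move=> Pu; elim: k => [|k IHk].
  rewrite (_ : map_mx _ d = const_mx 1) ?diag_const_mx ?mulmx1 ?mulVmx //.
  by apply/rowP => i; rewrite !mxE expr0.
rewrite exprS IHk -[_ * _]/(_ *m _) !mulmxA mulmxK // -(mulmxA (invmx P)) mulmx_diag.
by congr (_ *m diag_mx _ *m _); apply/rowP => i; rewrite !mxE exprS.
Qed.

Lemma sym_mxtrace_exp (R : rcfType) n (A : 'M[R]_n.+1) (s : n.+1.-tuple R) k :
  A^T = A -> char_poly A = \prod_(x <- s) ('X - x%:P) ->
  \tr (A ^+ k) = \sum_(x <- s) x ^+ k.
Proof.
move=> Asym /(sym_spectral Asym)[P [e [Pu _ AE s_e]]].
apply: (@complexI R); rewrite -[LHS](trace_map_mx (real_complex R)) rmorphXn /= AE.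
rewrite rmorph_sum (perm_big _ s_e) big_image /=.
rewrite conj_diag_mx_exp // mxtrace_mulC mulmxA mulmxV // mul1mx mxtrace_diag.
by apply: eq_bigr => i _; rewrite !mxE rmorphXn.
Qed.

(** In the coordinates [y] of [x] in the eigenbasis, the difference of the two sides is the sum of
    [|y_i|^2 * (e_i - m)]. *)
Lemma sym_rayleigh_ge (R : rcfType) n (A : 'M[R]_n) (s : n.-tuple R) (m : R) (x : 'rV_n) :
  A^T = A -> char_poly A = \prod_(x <- s) ('X - x%:P) ->
  {in s, forall y, m <= y} ->
  m * (x *m x^T) 0 0 <= (x *m A *m x^T) 0 0.
Proof.
move=> Asym /(sym_spectral Asym)[P [e [Pu PV AE s_e]]] m_le.
rewrite -subr_ge0 -ler0c rmorphB rmorphM /=.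
pose y := map_mx toC x *m map_mx Num.conj P^T.
have PK : map_mx Num.conj (map_mx Num.conj P^T)^T = P.
  by apply/matrixP => i j; rewrite !mxE conjCK.
have xC : map_mx Num.conj (map_mx toC x)^T = map_mx toC x^T.
  by apply/matrixP=> i j; rewrite !mxE; apply/CrealP/complex_realP; exists (x j i).
have yT : map_mx Num.conj y^T = P *m map_mx toC x^T.
  by rewrite trmx_mul map_mxM PK xC.
have toC00 (B : 'M[R]_1) : toC (B 0 0) = map_mx toC B 0 0 by rewrite mxE.
have -> : toC ((x *m x^T) 0 0) = (y *m map_mx Num.conj y^T) 0 0.
  by rewrite yT /y -PV mulmxA -(mulmxA _ (invmx P)) mulVmx // mulmx1 toC00 map_mxM.
have -> : toC ((x *m A *m x^T) 0 0) = (y *m diag_mx (map_mx toC e) *m map_mx Num.conj y^T) 0 0.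
  by rewrite yT /y -PV toC00 !map_mxM AE !mulmxA.
rewrite !mxE mulr_sumr -sumrB sumr_ge0 // => i _.
rewrite mul_mx_diag mxE (mxE _ _ _ i) [in map_mx toC e 0 i]mxE.
have -> : forall a b c d : R[i], a * b * c - d * (a * c) = a * c * (b - d).
  by move=> *; ring.
apply: mulr_ge0; first by rewrite !mxE mul_conjC_ge0.
by rewrite subr_ge0 lecR m_le // (perm_mem s_e) image_f.
Qed.

Lemma sym_double_eigenspace (R : rcfType) n (A : 'M[R]_n) (s : n.-tuple R) a :
  A^T = A -> char_poly A = \prod_(x <- s) ('X - x%:P) ->
  (1 < count_mem a s)%N -> (1 < \rank (kermx (A - a%:M)))%N.
Proof.
move=> Asym /(sym_spectral Asym)[P [e [Pu PV AE s_e]]].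
rewrite (permP s_e) count_map -sum1_count big_enum_cond sum1_card.
case/card_gt1P => i [j [/= /eqP ia /eqP ja ij]].
(* [W *m P] consists of the rows [i] and [j] of [P], two independent eigenvectors for [a]. *)
pose W : 'M[R[i]]_(2, n) := \matrix_(k, l) ((if k == 0 then i else j) == l)%:R.
have W_free : row_free W.
  apply/row_freeP; exists W^T; apply/matrixP => k l; rewrite !mxE.
  rewrite (bigD1 (if k == 0 then i else j)) //= big1 => [|h hk]; last first.
    by rewrite mxE eq_sym (negbTE hk) mul0r.
  rewrite !mxE eqxx mul1r addr0; case: k l => [[|[|//]] ?] [[|[|//]] ?] /=;
    by rewrite ?eqxx // 1?eq_sym ?(negbTE ij) // eq_sym (negbTE ij).
(* These eigenvectors are complex, but the rank of the kernel is the same over [R] and [R[i]]. *)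
rewrite -(mxrank_map (real_complex R)) map_kermx map_mxB AE map_scalar_mx.
apply: (@leq_trans (\rank (W *m P))).
  by rewrite mxrankMfree ?row_free_unit // (eqP W_free).
apply/mxrankS/sub_kermxP.
have -> : forall B : 'M[R[i]]_n, W *m P *m (invmx P *m B *m P - (toC a)%:M) =
    (W *m B - toC a *: W) *m P.
  by move=> B; rewrite mulmxBr mulmxBl !mulmxA mulmxK // mul_mx_scalar scalemxAl.
rewrite (_ : W *m _ - _ = 0) ?mul0mx //.
apply/matrixP => k l; rewrite mul_mx_diag !mxE.
case: eqP => [<-|_]; last by rewrite mul0r mulr0 subr0.
by rewrite mulrC; case: ifP; rewrite ?ia ?ja subrr.
Qed.

(** For [a != b] symmetry forces orthogonality. For [a = b] the eigenspace has dimension at least 2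
    and so meets the hyperplane orthogonal to [u]. *)
Lemma sym_orthogonal_eigenvectors (R : rcfType) n (A : 'M[R]_n) (s : n.-tuple R)
    a b (t : seq R) :
  A^T = A -> char_poly A = \prod_(x <- s) ('X - x%:P) ->
  perm_eq s [:: a, b & t] ->
  exists u v : 'rV_n,
    [/\ u != 0, v != 0, u *m A = a *: u, v *m A = b *: v & u *m v^T = 0].
Proof.
move=> Asym Aspec s_ab.
have eigA c : c \in s -> exists2 v : 'rV_n, v *m A = c *: v & v != 0.
  by rewrite -root_prod_XsubC -Aspec -eigenvalue_root_char => /eigenvalueP.
have [u uA u0] : exists2 v : 'rV_n, v *m A = a *: v & v != 0.
  by apply: eigA; rewrite (perm_mem s_ab) mem_head.
case: (eqVneq a b) => ab; last first.
  have [v vA v0] : exists2 v : 'rV_n, v *m A = b *: v & v != 0.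
    by apply: eigA; rewrite (perm_mem s_ab) !inE eqxx orbT.
  exists u, v; split=> //; apply/eqP.
  have : (a - b) *: (u *m v^T) == 0.
    by rewrite scalerBl scalemxAl -uA scalemxAr -linearZ /= -vA trmx_mul Asym mulmxA subrr.
  by rewrite scaler_eq0 subr_eq0 (negbTE ab).
have := @sym_double_eigenspace _ _ A s a Asym Aspec.
rewrite (permP s_ab) /= -ab eqxx => /(_ isT) ker_gt1.
have : (0 < \rank (kermx (A - a%:M) :&: kermx u^T)%MS)%N.
  have := mxrank_sum_cap (kermx (A - a%:M)) (kermx u^T).
  have := rank_leq_col (kermx (A - a%:M) + kermx u^T)%MS.
  rewrite [\rank (kermx u^T)]mxrank_ker.
  have := rank_leq_col u^T.
  lia.
rewrite lt0n mxrank_eq0 => /rowV0Pn[v]; rewrite sub_capmx => /andP[].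
move=> /sub_kermxP vA /sub_kermxP vu v0; exists u, v; split => //.
  by apply/eqP; rewrite -subr_eq0 -mul_mx_scalar -mulmxBr vA.
by rewrite -[u]trmxK -trmx_mul vu trmx0.
Qed.

(** * Necessary conditions *)

Definition pos_supp (R : realDomainType) n (v : 'rV[R]_n) : {set 'I_n} :=
  [set k | 0 < v 0 k].

(** At an index [i] where [v] is maximal, drop the nonpositive terms of [(v *m A) 0 i] and bound the
    other entries of [v] by [v 0 i]. This leaves [l <= A j i] for the only other positive index [j],
    or [l <= 0] if there is none. *)
Lemma nonneg_eigenvector_small_support (R : realDomainType) n (A : 'M[R]_n)
    (v : 'rV[R]_n) (a l : R) :
  (forall i j, 0 <= A i j) -> (forall i, A i i = 0) -> 0 < l -> l <= a ->
  v *m A = a *: v -> (0 < #|pos_supp v| <= 2)%N ->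
  exists i j, i != j /\ l <= A i j.
Proof.
move=> A_ge0 A_diag l_gt0 l_le vA /andP[/card_gt0P[i0]].
rewrite inE => v0 card_le2.
pose i := [arg max_(k > i0) v 0 k]%O.
have v_le k : v 0 k <= v 0 i.
  by rewrite /i; case: arg_maxP => // j _; apply.
have vi_gt0 : 0 < v 0 i := lt_le_trans v0 (v_le _).
set S := pos_supp v in card_le2; have iS : i \in S by rewrite inE.
have l_sum : l <= \sum_(k in S :\ i) A k i.
  rewrite -(ler_pM2l vi_gt0).
  apply: (@le_trans _ _ (a * v 0 i)); first by rewrite mulrC ler_wpM2r // ltW.
  have /rowP/(_ i) := vA; rewrite !mxE => <-.
  rewrite (bigID (mem S)) /= [X in X + _](bigD1 i) //= A_diag mulr0 add0r.
  apply: (@le_trans _ _ (\sum_(k in S :\ i) v 0 k * A k i)).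
    rewrite [X in X + _](eq_bigl (mem (S :\ i))); last first.
      by move=> k; rewrite !inE andbC.
    rewrite gerDl sumr_le0 // => k; rewrite inE -leNgt => vk_le0.
    exact: mulr_le0_ge0.
  rewrite mulr_sumr ler_sum // => k _; exact: ler_wpM2r.
have [SiE|[j jS]] := set_0Vmem (S :\ i).
  by move: l_sum; rewrite SiE big_set0 leNgt l_gt0.
have SE : S :\ i = [set j].
  apply/eqP; rewrite eq_sym eqEcard sub1set jS cards1.
  by move: card_le2; rewrite (cardsD1 i) iS.
exists j, i; split; last by move: l_sum; rewrite SE big_set1.
by move: jS; rewrite !inE => /andP[].
Qed.

(** Otherwise [v] and [- v] each have zero or at least three positive entries; with five entries in
    all, one of them has none. *)
Lemma nonneg_eigenvector_sign (R : realDomainType) (A : 'M[R]_5) (v : 'rV[R]_5) (a l : R) :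
  (forall i j, 0 <= A i j) -> (forall i, A i i = 0) -> 0 < l -> l <= a ->
  v *m A = a *: v -> v != 0 ->
  (exists i j, i != j /\ l <= A i j) \/
  exists w : 'rV[R]_5, [/\ w = v \/ w = - v, forall k, 0 <= w 0 k
     & (2 < #|pos_supp w|)%N].
Proof.
move=> A_ge0 A_diag l_gt0 l_le vA v_neq0.
have small w : w *m A = a *: w -> (0 < #|pos_supp w| <= 2)%N ->
    exists i j, i != j /\ l <= A i j.
  exact: nonneg_eigenvector_small_support.
have NvA : - v *m A = a *: - v by rewrite mulNmx vA scalerN.
have [/(small _ vA)|v_large] := boolP (0 < #|pos_supp v| <= 2)%N; first by left.
have [/(small _ NvA)|Nv_large] := boolP (0 < #|pos_supp (- v)| <= 2)%N; first by left.
right.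
have supp0 (w : 'rV[R]_5) : #|pos_supp w| = 0%N -> forall k, 0 <= (- w) 0 k.
  by move=> /cards0_eq w0 k; have := in_set0 k; rewrite -w0 inE mxE oppr_ge0 ltNge => /negbFE.
have supp_neq0 : #|pos_supp v| = 0%N -> #|pos_supp (- v)| = 0%N -> False.
  move=> /supp0 v_le0 /supp0; rewrite opprK => v_ge0; case/eqP: v_neq0.
  apply/rowP => k; apply/eqP; rewrite mxE eq_le v_ge0 -oppr_ge0.
  by have := v_le0 k; rewrite mxE => ->.
have : (#|pos_supp v| + #|pos_supp (- v)| <= 5)%N.
  rewrite -[leqRHS](card_ord 5) -(cardsC (pos_supp v)) leq_add2l subset_leq_card //.
  by apply/subsetP => k; rewrite !inE mxE oppr_gt0 -leNgt => /ltW.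
have [v0 _|v_gt0 le5] := eqVneq #|pos_supp v| 0%N.
  exists (- v); split; [by right | exact: supp0 |].
  by case: (#|_|) Nv_large supp_neq0 => [|[|[|]]] // _ /(_ v0 erefl).
have v_gt2 : (2 < #|pos_supp v|)%N by move: v_large v_gt0; case: (#|_|) => [|[|[|]]].
exists v; split => //; first by left.
rewrite -[v]opprK; apply: supp0.
by move: Nv_large le5; case: (#|pos_supp (- v)|) => [|[|[|m]]] // _; lia.
Qed.

Lemma nonneg_sym5_large_entry (R : rcfType) (A : 'M[R]_5) (s : 5.-tuple R)
    (a b : R) (t : seq R) :
  A^T = A -> char_poly A = \prod_(x <- s) ('X - x%:P) -> perm_eq s [:: a, b & t] ->
  (forall i j, 0 <= A i j) -> (forall i, A i i = 0) -> 0 < b -> b <= a ->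
  exists i j, i != j /\ b <= A i j.
Proof.
move=> Asym Aspec s_ab A_ge0 A_diag b_gt0 b_le.
have [u [v [u0 v0 uA vA uv]]] := sym_orthogonal_eigenvectors Asym Aspec s_ab.
have [//|[w [wu w_ge0 w_card]]] := nonneg_eigenvector_sign A_ge0 A_diag b_gt0 b_le uA u0.
have [//|[z [zv z_ge0 z_card]]] := nonneg_eigenvector_sign A_ge0 A_diag b_gt0 (lexx _) vA v0.
have wz : w *m z^T = 0.
  by case: wu zv => -> [] ->; rewrite ?linearN /= ?mulNmx ?mulmxN uv ?oppr0.
(* Orthogonal nonnegative vectors have disjoint supports, which is impossible for two supports of
   size at least 3 among 5 indices. *)
have disj : pos_supp w \subset ~: pos_supp z.
  apply/subsetP => k; rewrite !inE => wk; apply/negP => zk.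
  have /matrixP/(_ 0 0)/eqP := wz; rewrite !mxE psumr_eq0 => [/allP/(_ k)|j _].
    by rewrite mem_index_enum mxE mulf_eq0 !gt_eqF // => /(_ isT).
  by rewrite mxE mulr_ge0.
have := subset_leq_card disj; have := cardsC (pos_supp z); rewrite card_ord.
by move: w_card z_card; lia.
Qed.

Lemma nonneg_sym5_second_add_last_le0 (R : rcfType) (A : 'M[R]_5) (s : 5.-tuple R)
    (a b c : R) (t : seq R) :
  A^T = A -> char_poly A = \prod_(x <- s) ('X - x%:P) -> perm_eq s [:: a, b & t] ->
  (forall i j, 0 <= A i j) -> (forall i, A i i = 0) -> b <= a ->
  {in s, forall y, c <= y} -> b + c <= 0.
Proof.
move=> Asym Aspec s_ab A_ge0 A_diag b_le c_le.
have c_le_b : c <= b by apply: c_le; rewrite (perm_mem s_ab) !inE eqxx orbT.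
have [b_le0|b_gt0] := leP b 0; first by rewrite -[0]addr0 lerD // (le_trans c_le_b).
have [i [j [ij b_leA]]] := nonneg_sym5_large_entry Asym Aspec s_ab A_ge0 A_diag b_gt0 b_le.
pose x : 'rV[R]_5 := delta_mx 0 i - delta_mx 0 j.
have xBx (B : 'M_5) : (x *m B *m x^T) 0 0 = B i i - B i j - B j i + B j j.
  rewrite /x mulmxBl linearB /= !trmx_delta -!rowE mulmxBr -!colE !mxE.
  by ring.
have xx : (x *m x^T) 0 0 = 2.
  rewrite -[X in X *m _]mulmx1 xBx !mxE !eqxx (negbTE ij) eq_sym (negbTE ij) /=.
  by ring.
have := sym_rayleigh_ge x Asym Aspec c_le.
have -> : (x *m A *m x^T) 0 0 = - 2 * A i j.
  have Aji : A j i = A i j by rewrite -[in LHS]Asym mxE.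
  by rewrite xBx !A_diag Aji; ring.
by rewrite xx; lra.
Qed.

(** * The perturbation theorem *)

Lemma tz_sym_realizable_sorted (R : realType) (a b c d e : R) :
  sorted >=%R [:: a; b; c; d; e] -> - e <= a -> b + e <= 0 ->
  a + b + c + d + e = 0 ->
  0 <= a ^+ 3 + b ^+ 3 + c ^+ 3 + d ^+ 3 + e ^+ 3 ->
  tz_sym_realizable_seq 5 [:: a; b; c; d; e].
Proof.
move=> /= /and5P[ba cb dc ed _] ea be sum0 cubes_ge0.
(* In the first case the hypothesis [l2 <= p1 + p2] reads [b + c + d <= 0]; it follows from
   [- e <= a] and the zero sum. *)
rewrite -[d]opprK -[e]opprK; have [c_le0|c_gt0] := leP c 0.
  by rewrite -{1}[c]opprK; apply: tz_sym_realizable_two_pairs; lra.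
apply: tz_sym_realizable_reflection; lra.
Qed.

(* For unsorted tails, [l2 + l5 <= 0] says that every entry has a partner with
   which its sum is nonpositive; this form is stable under decreasing entries. *)
Lemma tz_sym_realizable5 (R : realType) (sigma : 5.-tuple R) :
  \sum_j tnth sigma j = 0 -> 0 <= \sum_j tnth sigma j ^+ 3 ->
  (forall j, j != ord0 -> `|tnth sigma j| <= tnth sigma ord0) ->
  (forall j, j != ord0 -> exists2 k, k != ord0 & tnth sigma j + tnth sigma k <= 0) ->
  tz_sym_realizable sigma.
Proof.
rewrite -(big_tuple _ _ sigma xpredT id) -(big_tuple _ _ sigma xpredT (fun x => x ^+ 3)).
move=> sum0 cubes_ge0 bound opp.
pose l := thead sigma; pose t := behead_tuple sigma.
have tail_t j : j != ord0 -> tnth sigma j \in t.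
  case: (unliftP ord0 j) => [k -> _|->]; last by rewrite eqxx.
  by rewrite (tuple_eta sigma) tnthS; apply: mem_tnth.
have t_tail x : x \in t -> exists2 j, j != ord0 & x = tnth sigma j.
  case/tnthP => k ->; exists (lift ord0 k) => //.
  by rewrite [in RHS](tuple_eta sigma) tnthS.
have t_perm : perm_eq (sort >=%R t) t by rewrite perm_sort.
have t_sorted : sorted >=%R (sort >=%R t) by apply/sort_sorted/ge_total.
have : size (sort >=%R t) = 4%N by rewrite size_sort size_tuple.
case: (sort _ t) t_perm t_sorted => [|b [|c [|d [|e [|//]]]]] // t_perm t_sorted _.
have sigma_perm : perm_eq [:: l; b; c; d; e] sigma.
  by rewrite [X in perm_eq _ (val X)](tuple_eta sigma) /= perm_cons.
have bcde x : x \in [:: b; c; d; e] ->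
    `|x| <= l /\ exists2 y, y \in [:: b; c; d; e] & x + y <= 0.
  rewrite (perm_mem t_perm) => /t_tail[j j0 ->]; split; first exact: bound.
  have [k k0 ?] := opp j j0; exists (tnth sigma k) => //.
  by rewrite (perm_mem t_perm) tail_t.
have [b_le [y y_bcde by_le0]] := bcde b (mem_head _ _).
have [e_le _] := bcde e (mem_last b [:: c; d; e]).
move: t_sorted => /= /and4P[cb dc ed _].
(* The partner [y] of the largest tail entry [b] may be replaced by the smallest entry:
   [b + e <= b + y <= 0]. *)
have e_le_y : e <= y.
  by move: y_bcde; rewrite !inE => /or4P[] /eqP->; lra.
have : tz_sym_realizable_seq 5 [:: l; b; c; d; e].
  move: b_le e_le; rewrite !ler_norml => /andP[_ b_le] /andP[e_ge _].
  apply: tz_sym_realizable_sorted; first by rewrite /= b_le cb dc ed.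
  - by lra.
  - by lra.
  - by rewrite -[RHS]sum0 -(perm_big _ sigma_perm) !big_cons big_nil /=; ring.
  - move: cubes_ge0; rewrite -(perm_big _ sigma_perm) !big_cons big_nil /= => /le_trans-> //.
    by rewrite le_eqVlt; apply/orP; left; apply/eqP; ring.
case=> A [A_tz A_char]; exists A; split => //.
by rewrite /has_spectrum A_char; apply: perm_big.
Qed.

(** Serves for the sum and for the sum of cubes, with [F] the identity and the cube. *)
Lemma sum_perturb (R : realType) (n : nat) (sigma : n.+1.-tuple R) (i : 'I_n.+1)
    (s : R) (F : R -> R) :
  i != ord0 ->
  \sum_j F (tnth (perturb sigma i s) j) =
  \sum_j F (tnth sigma j) + (F (tnth sigma ord0 + s) - F (tnth sigma ord0))
    + (F (tnth sigma i - s) - F (tnth sigma i)).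
Proof.
move=> i0; have sumE (G : 'I_n.+1 -> R) :
    \sum_j G j = G ord0 + (G i + \sum_(j | (j != ord0) && (j != i)) G j).
  by rewrite (bigD1 ord0) //= (bigD1 i).
rewrite !sumE !tnth_mktuple eqxx (negbTE i0) eqxx.
rewrite (eq_bigr (fun j => F (tnth sigma j))) => [|j /andP[j0 ji]]; first by ring.
by rewrite tnth_mktuple (negbTE j0) (negbTE ji).
Qed.

Lemma tz_sym_realizable5_necessary (R : realType) (sigma : 5.-tuple R) :
  (forall i j : 'I_5, (i <= j)%N -> tnth sigma j <= tnth sigma i) ->
  tz_sym_realizable sigma ->
  [/\ \sum_j tnth sigma j = 0, 0 <= \sum_j tnth sigma j ^+ 3
    & tnth sigma 1 + tnth sigma ord_max <= 0].
Proof.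
move=> decr [A [[Asym A_ge0 A_tr] Aspec]].
have A_diag j : A j j = 0.
  move/eqP: A_tr; rewrite psumr_eq0 => [/allP/(_ j)|k _]; last exact: A_ge0.
  by rewrite mem_index_enum => /(_ isT)/eqP.
split.
- have := sym_mxtrace_exp 1 Asym Aspec.
  by rewrite expr1 A_tr big_tuple => /esym; apply: etrans; apply: eq_bigr.
- rewrite -(big_tuple _ _ sigma xpredT (fun x => x ^+ 3)).
  rewrite -(sym_mxtrace_exp 3 Asym Aspec) sumr_ge0 // => j _.
  rewrite !exprS expr0 mulr1 mxE sumr_ge0 // => k _; rewrite mxE mulr_ge0 //.
  by rewrite sumr_ge0 // => m _; rewrite mulr_ge0.
- have sE : perm_eq sigma [:: tnth sigma 0, tnth sigma 1 & behead (behead sigma)].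
    by case: (sigma) => [[|a [|b r]] // size_s].
  apply: (nonneg_sym5_second_add_last_le0 Asym Aspec sE A_ge0 A_diag); first exact: decr.
  by move=> y /tnthP[j ->]; apply: decr; rewrite -ltnS.
Qed.

Theorem theorem3 (R : realType) (sigma : 5.-tuple R)
    (sigma_decr : forall i j : 'I_5, (i <= j)%N -> tnth sigma j <= tnth sigma i)
    (sigma_last : - tnth sigma ord0 <= tnth sigma ord_max)
    (sigma_real : tz_sym_realizable sigma)
    (s : R) (s_gt0 : 0 < s) (i : 'I_5) (i_neq0 : i != ord0) :
  tz_sym_realizable (perturb sigma i s).
Proof.
have [sum0 cubes_ge0 second_last] := tz_sym_realizable5_necessary sigma_decr sigma_real.
have le_first j : tnth sigma j <= tnth sigma ord0 by apply: sigma_decr.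
have ge_last j : tnth sigma ord_max <= tnth sigma j by apply: sigma_decr; rewrite -ltnS.
have le_second j : j != ord0 -> tnth sigma j <= tnth sigma 1.
  by move=> j0; apply: sigma_decr; rewrite /= lt0n.
have tail_bounds j : j != ord0 ->
    tnth sigma j - s <= tnth (perturb sigma i s) j <= tnth sigma j.
  by move=> j0; rewrite tnth_mktuple (negbTE j0); case: ifP => _; lra.
have first : tnth (perturb sigma i s) ord0 = tnth sigma ord0 + s by rewrite tnth_mktuple.
apply: tz_sym_realizable5.
- by rewrite (sum_perturb sigma s id i_neq0) sum0; ring.
- rewrite (sum_perturb sigma s (fun x => x ^+ 3) i_neq0).
  have := le_first i; have := le_trans sigma_last (ge_last i).
  move: (tnth sigma i) (tnth sigma ord0) => x y xy yx.
  have -> : forall z, z + ((y + s) ^+ 3 - y ^+ 3) + ((x - s) ^+ 3 - x ^+ 3) =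
    z + 3 * s * (x + y) * (y - x + s) by move=> *; ring.
  rewrite addr_ge0 // mulr_ge0 ?mulr_ge0 //; lra.
- move=> j j0; rewrite first ler_norml.
  have := tail_bounds j j0; have := le_first j; have := ge_last j; lra.
(* The last position is a partner for every [j]: no tail entry grows, so the new sum is at most
   [l2 + l5 <= 0]. *)
- move=> j j0; exists ord_max => //.
  have := tail_bounds j j0; have := tail_bounds ord_max isT; have := le_second j j0; lra.
Qed.
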